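(* Let $\alpha_1,\alpha_2,\alpha_3,\alpha_4>0$ be real numbers such that $\lambda=\alpha_1+\alpha_2+\alpha_3+\alpha_4$ satisfies $\lambda>2$ and $\alpha_i\le\frac{\lambda-\sqrt{\lambda^2-4}}2$ for $i=1,2,3,4$. Put $\delta_i=\sqrt{\alpha_i^2-\lambda\alpha_i+1}$ and assume $\delta_1\ge\delta_2\ge\delta_3\ge\delta_4>0$. Let $D_{ii}=\delta_i$ and $D_{ij}=\sqrt{\alpha_i\alpha_j}$ for $i\neq j$. Then the following are equivalent: 1. There exist $n\in\mathbb N$ and unitaries $v_{ij}\in M_n(\mathbb C)$ such that the block matrix $(D_{ij}v_{ij})_{i,j=1}^4$ is unitary in $M_{4n}(\mathbb C)$. 2. There exist unitaries $v_{ij}\in M_2(\mathbb C)$ such that $(D_{ij}v_{ij})_{i,j=1}^4$ is unitary in $M_8(\mathbb C)$. 3. $\delta_1-\delta_2-\delta_3-\delta_4\le0$.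
   Context: All notation is introduced in the claim. *)

(* Defs.v *)
From mathcomp Require Import all_boot all_order all_algebra.
From mathcomp Require Import spectral.
From mathcomp Require Import reals.
From mathcomp Require Import complex.

Set Implicit Arguments.
Unset Strict Implicit.
Unset Printing Implicit Defensive.

Import Order.TTheory GRing.Theory Num.Theory.
Local Open Scope ring_scope.
Local Open Scope complex_scope.

Section Defs.
Variables (R : realType) (alpha : 'I_4 -> R).

Definition lambda : R := \sum_(i < 4) alpha i.

Definition delta (i : 'I_4) : R :=
  Num.sqrt (alpha i ^+ 2 - lambda * alpha i + 1).

Definition Dmx : 'M[R]_4 :=
  \matrix_(i, j) if i == j then delta i else Num.sqrt (alpha i * alpha j).

(* The size of \mxblock is \sum_(i < 4) n, which equals 4 * n only
   propositionally. *)
Definition has_unitary_blocks (n : nat) : Prop :=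
  exists v : 'I_4 -> 'I_4 -> 'M[R[i]]_n,
    (forall i j, v i j \is unitarymx) /\
    \mxblock_(i < 4, j < 4) ((Dmx i j)%:C *: v i j) \is unitarymx.

End Defs.

(* Main.v *)
Require Import Defs.
From mathcomp Require Import all_boot all_order all_algebra.
From mathcomp Require Import spectral reals complex.
From mathcomp Require Import sesquilinear ring lra.

Set Implicit Arguments.
Unset Strict Implicit.
Unset Printing Implicit Defensive.

Import Order.TTheory GRing.Theory Num.Theory.
Local Open Scope ring_scope.

(** Indices run over 0, 1, 2, 3; write a_i, d_i for [alpha i], [delta i].

    Necessity, for blocks of any size n > 0.  In a unitary matrix cut into
    2 x 2 corners, the upper left corner P and the lower right corner S have
    the same singular values, so tr (P P')^2 = tr (S S')^2, where ' is the
    adjoint.  Each side depends on the unitaries v_ij only through the real part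
    of one trace, which lies between - n and n; the extreme values give
      (a_2 a_3 - d_2 d_3)^2 <= (a_0 a_1 + d_0 d_1)^2
    ([unitary_blocks_sqr_le]), because for instance x = a_0 a_1 + d_0 d_1 is a
    root of x^2 + (a_0 + a_1)(a_2 + a_3) - 1
      = 2 a_0 a_1 (x + lambda (a_2 + a_3) / 2 - 1).
    As d_0^2 + d_1^2 + 2 a_0 a_1 = d_2^2 + d_3^2 + 2 a_2 a_3, this amounts to
    (d_0 - d_1)^2 <= (d_2 + d_3)^2 ([unitary_blocks_delta_le]).

    Sufficiency, with 2 x 2 blocks.  The blocks are multiples of quaternions,
    and the unitary is h + K with h real and K skew-hermitian.  Up to
    multiplying rows and columns by unit quaternions, K is given by three
    vectors a, b, c of R^3 and a nonzero real t.  The numbers a_1 t + a,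
    a_2 t + b and a_3 t + c are unit quaternions whose product has real part
    a_0 t, that is, a spherical quadrilateral with sides arccos (a_i t).  The only
    remaining condition is that h^2 = d_0^2 - |xi|^2 be nonnegative, where - xi
    is the imaginary part of the first diagonal block
    ([quaternion_construction]).  Two explicit quadrilaterals suffice,
    according to the sign of
      E = UV - UW - VW,  U = a_2 a_3 - a_0 a_1,  V = a_1 a_3 - a_0 a_2,
      W = a_1 a_2 - a_0 a_3.
    - If E < 0, there is a t for which the quadrilateral degenerates to an arc;
      a, b, c are then collinear, t comes from Brahmagupta's formula, and the
      imaginary parts - n_0, n_1, n_2, n_3 of the diagonal blocks sum to 0,
      with n_i >= 0 and d_i^2 - n_i^2 = h^2 for all i.  In that situation
      h^2 >= 0 follows from d_0 <= d_1 + d_2 + d_3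
      ([momentum_defect], [unitary_blocks_degenerate]).
    - If E >= 0, there is a quadrilateral with xi = 0 once the index of
      the largest a_i, which is 3, is put first; then h = d_3 works
      ([unitary_blocks_balanced]). *)

Lemma sum_ord2 (V : nmodType) (F : 'I_2 -> V) : \sum_i F i = F 0 + F 1.
Proof.
by rewrite !big_ord_recl big_ord0 addr0; congr (_ + F _); apply: val_inj.
Qed.

Lemma sum_ord4 (V : nmodType) (F : 'I_4 -> V) :
  \sum_i F i = F 0 + F 1 + F 2 + F 3.
Proof.
by rewrite !big_ord_recl big_ord0 addr0 !addrA; do !congr (_ + _);
   congr F; apply: val_inj.
Qed.

Lemma ord4P (i : 'I_4) : [\/ i = 0, i = 1, i = 2 | i = 3].
Proof.
by case: i => [[|[|[|[|//]]]] hi]; [constructor 1 | constructor 2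
  | constructor 3 | constructor 4]; apply: val_inj.
Qed.

(** * Corners of unitary block matrices *)

Section Blocks.
Local Open Scope sesquilinear_scope.
Variable C : numClosedFieldType.

Lemma ctmxM (m n p : nat) (A : 'M[C]_(m, n)) (B : 'M[C]_(n, p)) :
  (A *m B)^t* = B^t* *m A^t*.
Proof. by rewrite trmx_mul map_mxM. Qed.

Lemma ctmxK (m n : nat) (A : 'M[C]_(m, n)) : (A^t*)^t* = A.
Proof. by apply/matrixP=> i j; rewrite !mxE conjCK. Qed.

Lemma ctmxD (m n : nat) (A B : 'M[C]_(m, n)) : (A + B)^t* = A^t* + B^t*.
Proof. by rewrite linearD map_mxD. Qed.

Lemma ctmxZ (m n : nat) c (A : 'M[C]_(m, n)) : (c *: A)^t* = c^* *: A^t*.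
Proof. by rewrite linearZ map_mxZ. Qed.

(** Unitarity of a block matrix as orthonormality of its block rows. *)
Lemma mxblock_unitaryP (p n : nat) (B : 'I_p -> 'I_p -> 'M[C]_n) :
  \mxblock_(i < p, j < p) B i j \is unitarymx <->
  forall i j, \sum_k B i k *m (B j k)^t* = (i == j)%:R%:M.
Proof.
have E : (\mxblock_(i < p, j < p) B i j)^t* =
         \mxblock_(i < p, j < p) (B j i)^t*.
  by apply/matrixP=> x y; rewrite !mxE.
have I1 : 1%:M = \mxblock_(i < p, j < p) ((i == j)%:R%:M : 'M[C]_n).
  rewrite -mxdiagZ /mxdiag; apply: eq_mxblock => i j.
  by case: eqP => // _; rewrite ?conform_mx_id // raddf0.
split=> [/unitarymxP|H].
  by rewrite E mul_mxblock I1 => /eq_mxblockP.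
by apply/unitarymxP; rewrite E mul_mxblock I1; apply: eq_mxblock.
Qed.

Lemma mxtrace_adj_ge0 (m n : nat) (A : 'M[C]_(m, n)) : 0 <= \tr (A *m A^t*).
Proof.
apply: sumr_ge0 => i _; rewrite mxE; apply: sumr_ge0 => j _.
by rewrite !mxE mul_conjC_ge0.
Qed.

(** With ' for the adjoint, the trace depends only on the real part of
    tr (V W'), which lies between - n and n because V + W and V - W have
    nonnegative squared norm. *)
Lemma mxtrace_unitary_comb (n : nat) (x y : C) (V W : 'M[C]_n) :
  0 <= x -> 0 <= y -> V \is unitarymx -> W \is unitarymx ->
  (x - y) ^+ 2 * n%:R <= \tr ((x *: V + y *: W) *m (x *: V + y *: W)^t*)
    <= (x + y) ^+ 2 * n%:R.
Proof.
move=> x0 y0 /unitarymxP VV /unitarymxP WW.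
have ex (a b : C) : a \is Num.real -> b \is Num.real ->
    \tr ((a *: V + b *: W) *m (a *: V + b *: W)^t*) =
    (a ^+ 2 + b ^+ 2) * n%:R + a * b * \tr (V *m W^t* + W *m V^t*).
  move=> /CrealP ra /CrealP rb.
  rewrite ctmxD !ctmxZ ra rb mulmxDl !mulmxDr -!scalemxAl -!scalemxAr VV WW.
  by rewrite !mxtraceD !mxtraceZ mxtrace1; ring.
have r1 : (1 : C) \is Num.real := real1 _.
have rN1 : (-1 : C) \is Num.real by rewrite rpredN.
have := mxtrace_adj_ge0 (1 *: V + 1 *: W); rewrite (ex _ _ r1 r1) => H1.
have := mxtrace_adj_ge0 ((-1) *: V + 1 *: W); rewrite (ex _ _ rN1 r1) => H2.
rewrite (ex _ _ (ger0_real x0) (ger0_real y0)); move: (\tr _) H1 H2 => T H1 H2.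
have xy0 : 0 <= x * y by rewrite mulr_ge0.
apply/andP; split; rewrite -subr_ge0.
  rewrite (_ : _ - _ = x * y * ((1 ^+ 2 + 1 ^+ 2) * n%:R + 1 * 1 * T));
    last by ring.
  exact: mulr_ge0.
rewrite (_ : _ - _ = x * y * (((-1) ^+ 2 + 1 ^+ 2) * n%:R + -1 * 1 * T));
    last by ring.
exact: mulr_ge0.
Qed.

(** P and S are opposite corners of a unitary with upper right corner Q; with
    ' for the adjoint, P P' and S' S are the complements to 1 of Q Q' and Q' Q. *)
Lemma mxtrace_corner (n : nat) (P Q S : 'M[C]_n) :
  P *m P^t* + Q *m Q^t* = 1%:M -> Q^t* *m Q + S^t* *m S = 1%:M ->
  \tr (P *m P^t* *m (P *m P^t*)) = \tr (S *m S^t* *m (S *m S^t*)).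
Proof.
have sq (K : 'M[C]_n) : \tr ((1%:M - K) *m (1%:M - K)) =
    \tr (1%:M : 'M[C]_n) - \tr K *+ 2 + \tr (K *m K).
  rewrite mulmxBl !mulmxBr !mul1mx mulmx1 !raddfB /=; ring.
move=> /(canRL (addrK _)) -> ES.
have {}ES : S^t* *m S = 1%:M - Q^t* *m Q by rewrite -ES addrC addKr.
have cyc (K : 'M[C]_n) : \tr (K *m K^t* *m (K *m K^t*)) =
    \tr (K^t* *m K *m (K^t* *m K)) by rewrite -!mulmxA mxtrace_mulC -!mulmxA.
by rewrite cyc ES !sq cyc (mxtrace_mulC Q).
Qed.
(** With ' for the adjoint, the diagonal blocks of P P' are scalar and the
    upper right one is z times a combination of two unitaries with weights
    x and y. *)
Lemma mxtrace_corner_bounds (n : nat) (x y z : C)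
    (V00 V01 V10 V11 : 'M[C]_n) :
  0 <= x -> 0 <= y -> 0 <= z -> 
  V00 \is unitarymx -> V01 \is unitarymx ->
  V10 \is unitarymx -> V11 \is unitarymx ->
  let P := block_mx (x *: V00) (z *: V01) (z *: V10) (y *: V11) in
  let c := (x ^+ 2 + z ^+ 2) ^+ 2 + (y ^+ 2 + z ^+ 2) ^+ 2 in
  (c + 2 * z ^+ 2 * (x - y) ^+ 2) * n%:R <= \tr (P *m P^t* *m (P *m P^t*)) /\
  \tr (P *m P^t* *m (P *m P^t*)) <= (c + 2 * z ^+ 2 * (x + y) ^+ 2) * n%:R.
Proof.
move=> x0 y0 z0 U00 U01 U10 U11 P c.
have [V00V V01V V10V V11V] : [/\ V00 *m V00^t* = 1%:M, V01 *m V01^t* = 1%:M,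
    V10 *m V10^t* = 1%:M & V11 *m V11^t* = 1%:M].
  by split; apply/unitarymxP.
have [rx ry rz] : [/\ x^* = x, y^* = y & z^* = z].
  by split; apply/CrealP; rewrite ger0_real.
pose W0 := V00 *m V10^t*; pose W1 := V01 *m V11^t*.
pose K := x *: W0 + y *: W1.
have -> : P *m P^t* = block_mx (x ^+ 2 + z ^+ 2)%:M (z *: K)
                               (z *: K^t*) (y ^+ 2 + z ^+ 2)%:M.
  rewrite /P tr_block_mx map_block_mx mulmx_block !ctmxZ rx ry rz.
  rewrite -!scalemxAl -!scalemxAr V00V V01V V10V V11V !scalerA.
  have s1 a : a *: (1%:M : 'M[C]_n) = a%:M by rewrite scalemx1.
  rewrite !s1 -!raddfD -!expr2 /= [z ^+ 2 + _]addrC.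
  congr block_mx.
    by rewrite /K /W0 /W1 scalerDr !scalerA [x * z]mulrC.
  rewrite /K /W0 /W1 ctmxD !ctmxZ !ctmxM !ctmxK rx ry scalerDr !scalerA.
  by rewrite [y * z]mulrC.
rewrite mulmx_block mxtrace_block !mxtraceD -!scalemxAl -!scalemxAr !mxtraceZ.
rewrite -!scalar_mxM !mxtrace_scalar [\tr (K^t* *m K)]mxtrace_mulC.
have /andP[L U] := mxtrace_unitary_comb x0 y0
  (mul_unitarymx U00 (etrans (trmxC_unitary _) U10))
  (mul_unitarymx U01 (etrans (trmxC_unitary _) U11)).
rewrite -/W0 -/W1 -/K in L U; move: (\tr _) L U => T L U.
have zz : 0 <= 2 * z ^+ 2 by rewrite mulr_ge0 ?exprn_ge0.
have tr_eq : (x ^+ 2 + z ^+ 2) * (x ^+ 2 + z ^+ 2) *+ n + z * (z * T) +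
    (z * (z * T) + (y ^+ 2 + z ^+ 2) * (y ^+ 2 + z ^+ 2) *+ n) =
    c * n%:R + 2 * z ^+ 2 * T.
  by rewrite -!(mulr_natr (_ * _) n) /c; ring.
rewrite tr_eq !(mulrDl c) !lerD2l -!(mulrA (2 * z ^+ 2)).
by split; apply: ler_wpM2l.
Qed.

Lemma mul_block_adj (n : nat) (a b c d a' b' c' d' : 'M[C]_n) :
  block_mx a b c d *m (block_mx a' b' c' d')^t* =
  block_mx (a *m a'^t* + b *m b'^t*) (a *m c'^t* + b *m d'^t*)
           (c *m a'^t* + d *m b'^t*) (c *m c'^t* + d *m d'^t*).
Proof. by rewrite tr_block_mx map_block_mx mulmx_block. Qed.

Lemma mul_adj_block (n : nat) (a b c d a' b' c' d' : 'M[C]_n) :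
  (block_mx a b c d)^t* *m block_mx a' b' c' d' =
  block_mx (a^t* *m a' + c^t* *m c') (a^t* *m b' + c^t* *m d')
           (b^t* *m a' + d^t* *m c') (b^t* *m b' + d^t* *m d').
Proof. by rewrite tr_block_mx map_block_mx mulmx_block. Qed.

Lemma mxtrace_unitary_corner (n : nat) (B : 'I_4 -> 'I_4 -> 'M[C]_n) :
  \mxblock_(i < 4, j < 4) B i j \is unitarymx ->
  let P := block_mx (B 0 0) (B 0 1) (B 1 0) (B 1 1) in
  let S := block_mx (B 2 2) (B 2 3) (B 3 2) (B 3 3) in
  \tr (P *m P^t* *m (P *m P^t*)) = \tr (S *m S^t* *m (S *m S^t*)).
Proof.
move=> BU P S.
have rows := (mxblock_unitaryP _).1 BU.
have cols : forall i j, \sum_k (B k i)^t* *m B k j = (i == j)%:R%:M.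
  move: BU; rewrite -trmxC_unitary.
  have -> : (\mxblock_(i < 4, j < 4) B i j)^t* =
         \mxblock_(i < 4, j < 4) (B j i)^t*.
    by apply/matrixP=> x y; rewrite !mxE.
  move=> /mxblock_unitaryP H i j; rewrite -H; apply: eq_bigr => k _.
  by rewrite ctmxK.
have {}rows i j : B i 0 *m (B j 0)^t* + B i 1 *m (B j 1)^t* +
    (B i 2 *m (B j 2)^t* + B i 3 *m (B j 3)^t*) = (i == j)%:R%:M.
  by rewrite addrA -rows sum_ord4.
have {}cols i j : (B 0 i)^t* *m B 0 j + (B 1 i)^t* *m B 1 j +
    ((B 2 i)^t* *m B 2 j + (B 3 i)^t* *m B 3 j) = (i == j)%:R%:M.
  by rewrite addrA -cols sum_ord4.
apply: (@mxtrace_corner _ _ (block_mx (B 0 2) (B 0 3) (B 1 2) (B 1 3))).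
  by rewrite !mul_block_adj add_block_mx !rows /= raddf0 scalar_mx_block.
by rewrite !mul_adj_block add_block_mx !cols /= raddf0 scalar_mx_block.
Qed.

(** The lower bound for the upper left corner is at most the upper bound for
    the lower right one. *)
Lemma unitary_corner_le (n : nat) (D : 'I_4 -> 'I_4 -> C)
    (v : 'I_4 -> 'I_4 -> 'M[C]_n) :
  (0 < n)%N -> (forall i j, 0 <= D i j) -> (forall i j, D i j = D j i) ->
  (forall i j, v i j \is unitarymx) ->
  \mxblock_(i < 4, j < 4) (D i j *: v i j) \is unitarymx ->
  (D 0 0 ^+ 2 + D 0 1 ^+ 2) ^+ 2 + (D 1 1 ^+ 2 + D 0 1 ^+ 2) ^+ 2
    + 2 * D 0 1 ^+ 2 * (D 0 0 - D 1 1) ^+ 2 <=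
  (D 2 2 ^+ 2 + D 2 3 ^+ 2) ^+ 2 + (D 3 3 ^+ 2 + D 2 3 ^+ 2) ^+ 2
    + 2 * D 2 3 ^+ 2 * (D 2 2 + D 3 3) ^+ 2.
Proof.
move=> n0 D0 DC vU /mxtrace_unitary_corner /=.
rewrite (DC 1 0) (DC 3 2) => tr_eq.
have [_ ub] := mxtrace_corner_bounds (D0 2 2) (D0 3 3) (D0 2 3)
   (vU 2 2) (vU 2 3) (vU 3 2) (vU 3 3).
have [lb _] := mxtrace_corner_bounds (D0 0 0) (D0 1 1) (D0 0 1)
   (vU 0 0) (vU 0 1) (vU 1 0) (vU 1 1).
rewrite -tr_eq in ub; have := le_trans lb ub.
by rewrite ler_pM2r ?ltr0n.
Qed.

End Blocks.

(** * Necessity of the inequality *)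

Section Necessity.
Variables (R : realType) (alpha : 'I_4 -> R).
Hypothesis alpha_gt0 : forall i, 0 < alpha i.
Hypothesis delta_gt0 : forall i, 0 < delta alpha i.
Notation lam := (lambda alpha).

Lemma sqr_delta i : delta alpha i ^+ 2 = alpha i ^+ 2 - lam * alpha i + 1.
Proof. by rewrite sqr_sqrtr // ltW // -sqrtr_gt0; exact: delta_gt0. Qed.

Lemma Dmx_diag i : Dmx alpha i i = delta alpha i.
Proof. by rewrite mxE eqxx. Qed.

Lemma Dmx_offdiag i j :
  i != j -> Dmx alpha i j = Num.sqrt (alpha i * alpha j).
Proof. by move=> /negPf ij; rewrite mxE ij. Qed.

Lemma Dmx_sym i j : Dmx alpha i j = Dmx alpha j i.
Proof.
have [->//|ij] := eqVneq i j; rewrite (Dmx_offdiag ij) Dmx_offdiag.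
  by rewrite [alpha i * _]mulrC.
by rewrite eq_sym.
Qed.

Lemma DC_sym i j : (Dmx alpha i j)%:C%C = (Dmx alpha j i)%:C%C.
Proof. by rewrite Dmx_sym. Qed.

Lemma DC_ge0 i j : 0 <= (Dmx alpha i j)%:C%C.
Proof. by rewrite ler0c mxE; case: ifP => _; rewrite sqrtr_ge0. Qed.

Lemma unitary_blocks_sqr_le n : (0 < n)%N -> has_unitary_blocks alpha n ->
  (alpha 2 * alpha 3 - delta alpha 2 * delta alpha 3) ^+ 2 <=
  (alpha 0 * alpha 1 + delta alpha 0 * delta alpha 1) ^+ 2.
Proof.
move=> n0 [v [vU BU]].
have := unitary_corner_le n0 DC_ge0 DC_sym vU BU.
have toC (x y z w : R) :
  (x%:C%C ^+ 2 + y%:C%C ^+ 2) ^+ 2 + (z%:C%C ^+ 2 + y%:C%C ^+ 2) ^+ 2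
    + 2 * y%:C%C ^+ 2 * w%:C%C ^+ 2 =
  ((x ^+ 2 + y ^+ 2) ^+ 2 + (z ^+ 2 + y ^+ 2) ^+ 2 + 2 * y ^+ 2 * w ^+ 2)%:C%C.
  by rewrite !(rmorphD, rmorphM, rmorphXn, rmorph1).
rewrite -rmorphB -rmorphD !toC lecR !Dmx_diag (@Dmx_offdiag 0 1) //.
rewrite (@Dmx_offdiag 2 3) // => {toC}.
have sq i j : Num.sqrt (alpha i * alpha j) ^+ 2 = alpha i * alpha j.
  by rewrite sqr_sqrtr // mulr_ge0 // ltW.
rewrite !sq.
move: (sqr_delta 0) (sqr_delta 1) (sqr_delta 2) (sqr_delta 3).
have -> : lam = alpha 0 + alpha 1 + alpha 2 + alpha 3.
  by rewrite /lambda sum_ord4.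
move: (delta _ 0) (delta _ 1) (delta _ 2) (delta _ 3) => d0 d1 d2 d3.
move: (alpha 0) (alpha 1) (alpha 2) (alpha 3) => a0 a1 a2 a3.
move=> e0 e1 e2 e3 H.
(* with lambda = x + y + w, and x, y the two alphas of the corner *)
have key (x y w p q : R) : p ^+ 2 = x ^+ 2 - (x + y + w) * x + 1 ->
    q ^+ 2 = y ^+ 2 - (x + y + w) * y + 1 ->
    (p ^+ 2 + x * y) ^+ 2 + (q ^+ 2 + x * y) ^+ 2 + 2 * (x * y) * (p - q) ^+ 2
    = 4 - 4 * ((x + y) * w) + ((x + y) * w) ^+ 2 - 2 * (x * y + p * q) ^+ 2.
  move=> ep eq.
  have -> : (p - q) ^+ 2 = p ^+ 2 + q ^+ 2 - 2 * (p * q) by ring.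
  have -> : (x * y + p * q) ^+ 2 =
     (x * y) ^+ 2 + 2 * (x * y) * (p * q) + p ^+ 2 * q ^+ 2 by ring.
  by rewrite ep eq; ring.
have := H; rewrite (@key _ _ (a2 + a3)); last 2 first.
- by rewrite e0; ring.
- by rewrite e1; ring.
(* the upper bound for the other corner is the lower one with - d3 for d3 *)
have -> : d2 + d3 = d2 - (- d3) by ring.
rewrite -[d3 ^+ 2]sqrrN (@key _ _ (a0 + a1)); last 2 first.
- by rewrite e2; ring.
- by rewrite sqrrN e3; ring.
rewrite mulrN [(a2 + a3) * _]mulrC; lra.
Qed.

Lemma unitary_blocks_delta_le n : (0 < n)%N -> has_unitary_blocks alpha n ->
  delta alpha 0 <= delta alpha 1 + delta alpha 2 + delta alpha 3.
Proof.
move=> n0 /(unitary_blocks_sqr_le n0).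
move: (sqr_delta 0) (sqr_delta 1) (sqr_delta 2) (sqr_delta 3).
have -> : lam = alpha 0 + alpha 1 + alpha 2 + alpha 3.
  by rewrite /lambda sum_ord4.
move: (delta_gt0 0) (delta_gt0 1) (delta_gt0 2) (delta_gt0 3).
move: (alpha_gt0 0) (alpha_gt0 1) (alpha_gt0 2) (alpha_gt0 3).
move: (delta _ 0) (delta _ 1) (delta _ 2) (delta _ 3) => d0 d1 d2 d3.
move: (alpha 0) (alpha 1) (alpha 2) (alpha 3) => a0 a1 a2 a3.
move=> a0p a1p a2p a3p d0p d1p d2p d3p e0 e1 e2 e3 H.
have P0 : 0 <= a0 * a1 + d0 * d1 by rewrite addr_ge0 ?mulr_ge0 ?ltW.
have PP : a2 * a3 - d2 * d3 <= a0 * a1 + d0 * d1.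
  by rewrite leNgt; apply/negP => lt; have := lt; nra.
have sq : (d0 - d1) ^+ 2 <= (d2 + d3) ^+ 2.
  have -> : (d0 - d1) ^+ 2 = d0 ^+ 2 + d1 ^+ 2 - 2 * (d0 * d1) by ring.
  have -> : (d2 + d3) ^+ 2 = d2 ^+ 2 + d3 ^+ 2 + 2 * (d2 * d3) by ring.
  rewrite e0 e1 e2 e3; lra.
rewrite leNgt; apply/negP => lt; move: sq; nra.
Qed.
End Necessity.

(** * Quaternions as 2 x 2 complex matrices *)

Section Quaternions.
Local Open Scope sesquilinear_scope.
Variable R : realType.

(** The quaternion q0 + q1 i + q2 j + q3 k. *)
Record quat := Quat { q0 : R; q1 : R; q2 : R; q3 : R }.

(** The squared modulus. *)
Definition qnorm p := q0 p ^+ 2 + q1 p ^+ 2 + q2 p ^+ 2 + q3 p ^+ 2.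

(** The product of p with the conjugate of q. *)
Definition qmulc p q := Quat
  (q0 p * q0 q + q1 p * q1 q + q2 p * q2 q + q3 p * q3 q)
  (q1 p * q0 q - q0 p * q1 q + q3 p * q2 q - q2 p * q3 q)
  (q2 p * q0 q - q0 p * q2 q + q1 p * q3 q - q3 p * q1 q)
  (q3 p * q0 q - q0 p * q3 q + q2 p * q1 q - q1 p * q2 q).

Definition qadd p q :=
  Quat (q0 p + q0 q) (q1 p + q1 q) (q2 p + q2 q) (q3 p + q3 q).

(** The standard embedding of the quaternions in the 2 x 2 complex matrices,
    under which conjugation becomes the adjoint. *)
Definition qmx p : 'M[R[i]]_2 := \matrix_(i, j)
  if i == 0 then if j == 0 then Complex (q0 p) (q1 p) else Complex (q2 p) (q3 p)
  else if j == 0 then Complex (- q2 p) (q3 p) else Complex (q0 p) (- q1 p).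

Lemma qmxD p q : qmx (qadd p q) = qmx p + qmx q.
Proof.
apply/matrixP=> i j; rewrite !mxE; apply/eqP; rewrite eq_complex.
by do 2!case: ifP => _ /=; rewrite ?opprD !eqxx.
Qed.

Lemma qmxM p q : qmx p *m (qmx q)^t* = qmx (qmulc p q).
Proof.
apply/matrixP=> i j; rewrite !mxE sum_ord2 !mxE /=.
case: ifP => _; case: ifP => _; apply/eqP; rewrite eq_complex /=;
  by apply/andP; split; apply/eqP; ring.
Qed.

Lemma qmx_scalar (x : R) : qmx (Quat x 0 0 0) = (x%:C%C)%:M.
Proof.
apply/matrixP=> i j; rewrite !mxE; apply/eqP; rewrite eq_complex.
case: i j => [[|[|//]] hi] [[|[|//]] hj] /=; by rewrite ?oppr0 !eqxx.
Qed.

Lemma qmulcC p q : qmulc q p =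
  Quat (q0 (qmulc p q)) (- q1 (qmulc p q))
       (- q2 (qmulc p q)) (- q3 (qmulc p q)).
Proof. by rewrite /qmulc /=; congr Quat; ring. Qed.

Lemma qmulcc p : qmulc p p = Quat (qnorm p) 0 0 0.
Proof. by rewrite /qmulc /qnorm /=; congr Quat; ring. Qed.

End Quaternions.

(** * Unitaries from quaternions *)

Section Construction.
Variables (R : realType) (alpha : 'I_4 -> R).
Hypothesis alpha_gt0 : forall i, 0 < alpha i.
Hypothesis delta_gt0 : forall i, 0 < delta alpha i.
Notation lam := (lambda alpha).

Lemma Dmx_gt0 i j : 0 < Dmx alpha i j.
Proof. by rewrite mxE; case: ifP => _ //; rewrite sqrtr_gt0 mulr_gt0. Qed.

Lemma sqr_Dmx i j : Dmx alpha i j ^+ 2 =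
  if i == j then alpha i ^+ 2 - lam * alpha i + 1 else alpha i * alpha j.
Proof.
rewrite mxE; case: ifP => _; first exact: sqr_delta.
by rewrite sqr_sqrtr // mulr_ge0 // ltW.
Qed.

Lemma sum_sqr_Dmx i : \sum_k Dmx alpha i k ^+ 2 = 1.
Proof.
under eq_bigr do rewrite sqr_Dmx.
rewrite (bigD1 i) //= eqxx.
rewrite (eq_bigr (fun k => alpha i * alpha k)); last first.
  by move=> k; rewrite eq_sym => /negPf ->.
by rewrite -mulr_sumr /lambda (bigD1 i) //=; ring.
Qed.

(** The (i, j) block of the product of B and its adjoint. *)
Definition qrow (B : 'I_4 -> 'I_4 -> quat R) i j :=
  qadd (qadd (qadd (qmulc (B i 0) (B j 0)) (qmulc (B i 1) (B j 1)))
     (qmulc (B i 2) (B j 2))) (qmulc (B i 3) (B j 3)).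

Lemma quat_unitary_blocks (B : 'I_4 -> 'I_4 -> quat R) :
  (forall i j, qnorm (B i j) = Dmx alpha i j ^+ 2) ->
  (forall i j : 'I_4, (i < j)%N -> qrow B i j = Quat 0 0 0 0) ->
  has_unitary_blocks alpha 2.
Proof.
move=> Bn Bo; exists (fun i j => ((Dmx alpha i j)^-1)%:C%C *: qmx (B i j)).
have D0 i j : Dmx alpha i j != 0 by rewrite gt_eqF ?Dmx_gt0.
have cR (x : R) : (x%:C%C : R[i])^* = x%:C%C by exact: conjc_real.
split=> [i j|].
  apply/unitarymxP; rewrite ctmxZ -scalemxAl -scalemxAr scalerA qmxM qmulcc Bn.
  rewrite qmx_scalar scale_scalar_mx cR -!rmorphM /=.
  by rewrite (_ : _ * _ = 1) ?rmorph1 //; field.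
apply/mxblock_unitaryP=> i j.
have E i' j' : (Dmx alpha i' j')%:C%C *:
    ((Dmx alpha i' j')^-1%:C%C *: qmx (B i' j')) = qmx (B i' j').
  by rewrite scalerA -rmorphM mulfV // rmorph1 scale1r.
transitivity (qmx (qrow B i j)).
  by rewrite sum_ord4 !qmxD -!qmxM !E.
have [<-|ij] := eqVneq i j.
  rewrite /qrow !qmulcc !Bn /qadd /= !addr0 qmx_scalar.
  by rewrite -(sum_ord4 (fun k => Dmx alpha i k ^+ 2)) sum_sqr_Dmx rmorph1.
have [lt|gt|/val_inj e] := ltngtP i j; last by rewrite e eqxx in ij.
  by rewrite Bo // qmx_scalar rmorph0.
have -> : qrow B i j = Quat 0 0 0 0; last by rewrite qmx_scalar rmorph0.
have := Bo _ _ gt; rewrite /qrow !(qmulcC (B j _) (B i _)) /qadd /=.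
by case=> e0 e1 e2 e3; congr Quat; lra.
Qed.

Lemma lin1 (k e l r : R) : l = r -> e = k * (l - r) -> e = 0.
Proof. by move=> -> ->; rewrite subrr mulr0. Qed.

Lemma lin2 (k k' e l r l' r' : R) :
  l = r -> l' = r' -> e = k * (l - r) + k' * (l' - r') -> e = 0.
Proof. by move=> -> -> ->; rewrite !subrr !mulr0 addr0. Qed.

(** The blocks of the unitary h + K.  The block (i, j), for i <> j, is
    sqrt (alpha i * alpha j) times a unit quaternion, which is -1 or 1 in the
    first row and column and otherwise has real part plus or minus
    alpha l * t, where l is the remaining nonzero index. *)
Definition qblocks (t h a1 a2 a3 b1 b2 b3 c1 c2 c3 x1 x2 x3 : R)
    (i j : 'I_4) : quat R :=
  let s k := Num.sqrt (alpha k) in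
  let off (w x y z : R) :=
    Quat (s i * s j * w) (s i * s j * x) (s i * s j * y) (s i * s j * z) in
  match val i, val j with
  | 0, 0 => Quat h (- x1) (- x2) (- x3)
  | 0, _ => off (-1) 0 0 0
  | _, 0 => off 1 0 0 0
  | 1, 1 => Quat h (x1 - alpha 2 * c1 - alpha 3 * b1)
                 (x2 - alpha 2 * c2 - alpha 3 * b2)
                 (x3 - alpha 2 * c3 - alpha 3 * b3)
  | 2, 2 => Quat h (x1 - alpha 1 * c1 - alpha 3 * a1)
                 (x2 - alpha 1 * c2 - alpha 3 * a2)
                 (x3 - alpha 1 * c3 - alpha 3 * a3)
  | 3, 3 => Quat h (x1 - alpha 1 * b1 - alpha 2 * a1)
                 (x2 - alpha 1 * b2 - alpha 2 * a2)
                 (x3 - alpha 1 * b3 - alpha 2 * a3)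
  | 1, 2 => off (alpha 3 * t) c1 c2 c3
  | 2, 1 => off (- (alpha 3 * t)) c1 c2 c3
  | 1, 3 => off (- (alpha 2 * t)) b1 b2 b3
  | 3, 1 => off (alpha 2 * t) b1 b2 b3
  | 2, 3 => off (alpha 1 * t) a1 a2 a3
  | _, _ => off (- (alpha 1 * t)) a1 a2 a3
  end.

(** The hypotheses say: alpha 1 * t + a, alpha 2 * t + b and alpha 3 * t + c
    are unit quaternions; their product has real part alpha 0 * t; 2 t xi is t
    times a fixed combination of a, b, c plus a x b + b x c + c x a; and h is as
    the norm of the first block demands.  The remaining norms and the
    orthogonality of the rows follow. *)
Lemma quaternion_construction (t h a1 a2 a3 b1 b2 b3 c1 c2 c3 x1 x2 x3 : R) :
  t != 0 ->
  a1 ^+ 2 + a2 ^+ 2 + a3 ^+ 2 = 1 - (alpha 1 * t) ^+ 2 ->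
  b1 ^+ 2 + b2 ^+ 2 + b3 ^+ 2 = 1 - (alpha 2 * t) ^+ 2 ->
  c1 ^+ 2 + c2 ^+ 2 + c3 ^+ 2 = 1 - (alpha 3 * t) ^+ 2 ->
  t * (alpha 1 * (b1 * c1 + b2 * c2 + b3 * c3) +
       alpha 2 * (a1 * c1 + a2 * c2 + a3 * c3) +
       alpha 3 * (a1 * b1 + a2 * b2 + a3 * b3) +
       alpha 0 - alpha 1 * alpha 2 * alpha 3 * t ^+ 2) +
    (a1 * (b2 * c3 - b3 * c2) + a2 * (b3 * c1 - b1 * c3)
      + a3 * (b1 * c2 - b2 * c1)) = 0 ->
  2 * t * x1 = t * ((alpha 2 + alpha 3) * a1 + (alpha 1 + alpha 3) * b1
      + (alpha 1 + alpha 2) * c1) +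
    ((a2 * b3 - a3 * b2) + (b2 * c3 - b3 * c2) + (c2 * a3 - c3 * a2)) ->
  2 * t * x2 = t * ((alpha 2 + alpha 3) * a2 + (alpha 1 + alpha 3) * b2
      + (alpha 1 + alpha 2) * c2) +
    ((a3 * b1 - a1 * b3) + (b3 * c1 - b1 * c3) + (c3 * a1 - c1 * a3)) ->
  2 * t * x3 = t * ((alpha 2 + alpha 3) * a3 + (alpha 1 + alpha 3) * b3
      + (alpha 1 + alpha 2) * c3) +
    ((a1 * b2 - a2 * b1) + (b1 * c2 - b2 * c1) + (c1 * a2 - c2 * a1)) ->
  h ^+ 2 + (x1 ^+ 2 + x2 ^+ 2 + x3 ^+ 2) = delta alpha 0 ^+ 2 ->
  has_unitary_blocks alpha 2.
Proof.
rewrite (sqr_delta delta_gt0) => t0 Na Nb Nc Det X1 X2 X3 Nx.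
have [s0 [s1 [s2 [s3 [S0 S1 S2 S3]]]]] : exists s0 s1 s2 s3,
  [/\ Num.sqrt (alpha 0) = s0, Num.sqrt (alpha 1) = s1,
      Num.sqrt (alpha 2) = s2 & Num.sqrt (alpha 3) = s3].
  by do 4!eexists.
have [A0 A1 A2 A3] : [/\ alpha 0 = s0 ^+ 2, alpha 1 = s1 ^+ 2,
   alpha 2 = s2 ^+ 2 & alpha 3 = s3 ^+ 2].
  by split; rewrite -(S0, S1, S2, S3) sqr_sqrtr // ltW.
have L : lam = alpha 0 + alpha 1 + alpha 2 + alpha 3.
  by rewrite /lambda sum_ord4.
(* the inner products of xi with a, b and c *)
have Xa : 2 * (x1 * a1 + x2 * a2 + x3 * a3) =
    (alpha 2 + alpha 3) * (1 - (alpha 1 * t) ^+ 2) +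
    alpha 1 * ((a1 * c1 + a2 * c2 + a3 * c3) + (a1 * b1 + a2 * b2 + a3 * b3)
       - (b1 * c1 + b2 * c2 + b3 * c3))
    - alpha 0 + alpha 1 * alpha 2 * alpha 3 * t ^+ 2.
  apply: (mulfI t0); rewrite -Na.
  transitivity (a1 * (2 * t * x1) + a2 * (2 * t * x2) + a3 * (2 * t * x3)).
    by ring.
  rewrite X1 X2 X3; apply/eqP; rewrite -subr_eq0 -Det; apply/eqP; ring.
have Xb : 2 * (x1 * b1 + x2 * b2 + x3 * b3) =
    (alpha 1 + alpha 3) * (1 - (alpha 2 * t) ^+ 2) +
    alpha 2 * ((b1 * c1 + b2 * c2 + b3 * c3) + (a1 * b1 + a2 * b2 + a3 * b3)
       - (a1 * c1 + a2 * c2 + a3 * c3))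
    - alpha 0 + alpha 1 * alpha 2 * alpha 3 * t ^+ 2.
  apply: (mulfI t0); rewrite -Nb.
  transitivity (b1 * (2 * t * x1) + b2 * (2 * t * x2) + b3 * (2 * t * x3)).
    by ring.
  rewrite X1 X2 X3; apply/eqP; rewrite -subr_eq0 -Det; apply/eqP; ring.
have Xc : 2 * (x1 * c1 + x2 * c2 + x3 * c3) =
    (alpha 1 + alpha 2) * (1 - (alpha 3 * t) ^+ 2) +
    alpha 3 * ((b1 * c1 + b2 * c2 + b3 * c3) + (a1 * c1 + a2 * c2 + a3 * c3)
       - (a1 * b1 + a2 * b2 + a3 * b3))
    - alpha 0 + alpha 1 * alpha 2 * alpha 3 * t ^+ 2.
  apply: (mulfI t0); rewrite -Nc.
  transitivity (c1 * (2 * t * x1) + c2 * (2 * t * x2) + c3 * (2 * t * x3)).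
    by ring.
  rewrite X1 X2 X3; apply/eqP; rewrite -subr_eq0 -Det; apply/eqP; ring.
apply: (@quat_unitary_blocks (qblocks t h a1 a2 a3 b1 b2 b3 c1 c2 c3 x1 x2 x3)).
  move=> i j; rewrite sqr_Dmx.
  case: (ord4P i) => ->; case: (ord4P j) => -> /=;
    rewrite /qnorm /qblocks /= ?S0 ?S1 ?S2 ?S3 ?L.
  - rewrite L in Nx; lra.
  1-4,8,12: by rewrite ?A0 ?A1 ?A2 ?A3; ring.
  - have := congr1 ( *%R (alpha 2)) Xc; have := congr1 ( *%R (alpha 3)) Xb.
    have := congr1 ( *%R (alpha 2 ^+ 2)) Nc.
    have := congr1 ( *%R (alpha 3 ^+ 2)) Nb.
    rewrite L in Nx; move: Nx; clear; lra.
  - by have := congr1 ( *%R (s1 ^+ 2 * s2 ^+ 2)) Nc; rewrite A1 A2; lra.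
  - by have := congr1 ( *%R (s1 ^+ 2 * s3 ^+ 2)) Nb; rewrite A1 A3; lra.
  - by have := congr1 ( *%R (s2 ^+ 2 * s1 ^+ 2)) Nc; rewrite A2 A1; lra.
  - have := congr1 ( *%R (alpha 1)) Xc; have := congr1 ( *%R (alpha 3)) Xa.
    have := congr1 ( *%R (alpha 1 ^+ 2)) Nc.
    have := congr1 ( *%R (alpha 3 ^+ 2)) Na.
    rewrite L in Nx; move: Nx; clear; lra.
  - by have := congr1 ( *%R (s2 ^+ 2 * s3 ^+ 2)) Na; rewrite A2 A3; lra.
  - by have := congr1 ( *%R (s3 ^+ 2 * s1 ^+ 2)) Nb; rewrite A3 A1; lra.
  - by have := congr1 ( *%R (s3 ^+ 2 * s2 ^+ 2)) Na; rewrite A3 A2; lra.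
  - have := congr1 ( *%R (alpha 1)) Xb; have := congr1 ( *%R (alpha 2)) Xa.
    have := congr1 ( *%R (alpha 1 ^+ 2)) Nb.
    have := congr1 ( *%R (alpha 2 ^+ 2)) Na.
    rewrite L in Nx; move: Nx; clear; lra.
move=> i j; case: (ord4P i) => ->; case: (ord4P j) => -> lt.
(* only the pairs i < j remain *)
all: try (exfalso; move: lt; rewrite /is_true; vm_compute; discriminate).
all: rewrite /qrow.
all: rewrite /qblocks /=.
all: rewrite ?S0 ?S1 ?S2 ?S3.
all: rewrite /qmulc /=.
all: rewrite /qadd /=.
- by rewrite A2 A3; congr Quat; ring.
- by rewrite A1 A3; congr Quat; ring.
- by rewrite A1 A2; congr Quat; ring.
- congr Quat; last 3 first.
  + by apply: (lin1 X1 (k := - s1 * s2 * alpha 3));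
      rewrite ?A0 ?A1 ?A2 ?A3; ring.
  + by apply: (lin1 X2 (k := - s1 * s2 * alpha 3));
      rewrite ?A0 ?A1 ?A2 ?A3; ring.
  + by apply: (lin1 X3 (k := - s1 * s2 * alpha 3));
      rewrite ?A0 ?A1 ?A2 ?A3; ring.
  apply: (lin2 Xc Nc (k := s1 * s2) (k' := - s1 * s2 * (alpha 1 + alpha 2))).
  by rewrite ?A0 ?A1 ?A2 ?A3; ring.
- congr Quat; last 3 first.
  + by apply: (lin1 X1 (k := s1 * s3 * alpha 2));
      rewrite ?A0 ?A1 ?A2 ?A3; ring.
  + by apply: (lin1 X2 (k := s1 * s3 * alpha 2));
      rewrite ?A0 ?A1 ?A2 ?A3; ring.
  + by apply: (lin1 X3 (k := s1 * s3 * alpha 2));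
      rewrite ?A0 ?A1 ?A2 ?A3; ring.
  apply: (lin2 Xb Nb (k := s1 * s3) (k' := - s1 * s3 * (alpha 1 + alpha 3))).
  by rewrite ?A0 ?A1 ?A2 ?A3; ring.
- congr Quat; last 3 first.
  + by apply: (lin1 X1 (k := - s2 * s3 * alpha 1));
      rewrite ?A0 ?A1 ?A2 ?A3; ring.
  + by apply: (lin1 X2 (k := - s2 * s3 * alpha 1));
      rewrite ?A0 ?A1 ?A2 ?A3; ring.
  + by apply: (lin1 X3 (k := - s2 * s3 * alpha 1));
      rewrite ?A0 ?A1 ?A2 ?A3; ring.
  apply: (lin2 Xa Na (k := s2 * s3) (k' := - s2 * s3 * (alpha 2 + alpha 3))).
  by rewrite ?A0 ?A1 ?A2 ?A3; ring.
Qed.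
End Construction.

(** * A quadrilateral degenerate to an arc *)

(** If d_i^2 - n_i^2 were a common negative number - G, then expanding squares
    would give d_0^2 <= (d_1 + d_2 + d_3)^2 <= n_0^2 - 3 G < n_0^2 - G. *)
Lemma momentum_defect (R : realFieldType) (d0 d1 d2 d3 n0 n1 n2 n3 : R) :
  0 < d0 -> 0 < d1 -> 0 < d2 -> 0 < d3 -> 0 <= n1 -> 0 <= n2 -> 0 <= n3 ->
  n0 = n1 + n2 + n3 -> d0 <= d1 + d2 + d3 ->
  d1 ^+ 2 - n1 ^+ 2 = d0 ^+ 2 - n0 ^+ 2 ->
  d2 ^+ 2 - n2 ^+ 2 = d0 ^+ 2 - n0 ^+ 2 ->
  d3 ^+ 2 - n3 ^+ 2 = d0 ^+ 2 - n0 ^+ 2 ->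
  0 <= d0 ^+ 2 - n0 ^+ 2.
Proof.
move=> d0p d1p d2p d3p n1p n2p n3p en0 dle e1 e2 e3.
rewrite leNgt; apply/negP => H.
have le (d n : R) : 0 < d -> 0 <= n -> d ^+ 2 - n ^+ 2 < 0 -> d <= n.
  move=> d_gt0 n_ge0; rewrite subr_lt0 ltr_sqr ?nnegrE ?(ltW d_gt0) //.
  exact: ltW.
have l1 : d1 <= n1 by apply: le => //; rewrite e1.
have l2 : d2 <= n2 by apply: le => //; rewrite e2.
have l3 : d3 <= n3 by apply: le => //; rewrite e3.
have m12 : d1 * d2 <= n1 * n2 by rewrite ler_pM // ltW.
have m13 : d1 * d3 <= n1 * n3 by rewrite ler_pM // ltW.
have m23 : d2 * d3 <= n2 * n3 by rewrite ler_pM // ltW.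
have : d0 ^+ 2 <= (d1 + d2 + d3) ^+ 2.
  by rewrite ler_sqr ?nnegrE ?(ltW d0p) // !addr_ge0 // ltW.
move: H e1 e2 e3; rewrite en0; lra.
Qed.

Section DegenerateQuadrilateral.
Variables (R : realType) (alpha : 'I_4 -> R).
Hypothesis alpha_gt0 : forall i, 0 < alpha i.
Hypothesis delta_gt0 : forall i, 0 < delta alpha i.
Notation lam := (lambda alpha).

(** With - alpha 0 for alpha 0, these are the three sums of products of
    complementary pairs of sides that give the diagonals and the diameter of a
    quadrilateral inscribed in a circle. *)
Definition pairU := alpha 2 * alpha 3 - alpha 0 * alpha 1.
Definition pairV := alpha 1 * alpha 3 - alpha 0 * alpha 2.
Definition pairW := alpha 1 * alpha 2 - alpha 0 * alpha 3.
(** The quadrilateral can be chosen degenerate when this is negative. *)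
Definition pairE := pairU * pairV - pairU * pairW - pairV * pairW.

Hypothesis alpha01 : alpha 0 <= alpha 1.
Hypothesis alpha12 : alpha 1 <= alpha 2.
Hypothesis alpha23 : alpha 2 <= alpha 3.

Lemma pairE_ge0 : alpha 1 + alpha 2 <= alpha 0 + alpha 3 -> 0 <= pairE.
Proof.
move=> le.
(* the polynomial has nonnegative coefficients in the gaps x, z, y *)
have [x [x0 ex]] : exists x, 0 <= x /\ alpha 1 = alpha 0 + x.
  by exists (alpha 1 - alpha 0); rewrite subr_ge0; split=> //; ring.
have [z [z0 ez]] : exists z, 0 <= z /\ alpha 2 = alpha 0 + x + z.
  by exists (alpha 2 - alpha 1); rewrite subr_ge0 -ex; split=> //; ring.
have [y [y0 ey]] : exists y, 0 <= y /\ alpha 3 = alpha 0 + x + x + z + y.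
  by exists (alpha 3 + alpha 0 - alpha 1 - alpha 2); split; move: le ex ez; lra.
have a0 := ltW (alpha_gt0 0).
rewrite /pairE /pairU /pairV /pairW ey ez ex; move: (alpha 0) a0 => a a0.
rewrite [leRHS](_ : _ =
  a ^+ 2 * (4 * x ^+ 2 + 8 * (x * y) + 4 * (x * z) + 4 * (z * y) + 3 * y ^+ 2)
  + a * (4 * x ^+ 3 + 6 * (x ^+ 2 * z) + 10 * (x ^+ 2 * y) + 2 * (x * z ^+ 2)
     + 10 * (x * z * y) + 4 * (x * y ^+ 2) + 2 * (z ^+ 2 * y)
     + 2 * (z * y ^+ 2))
  + (2 * (x ^+ 3 * y) + 3 * (x ^+ 2 * z * y) + x ^+ 2 * y ^+ 2
     + x * z ^+ 2 * y + x * z * y ^+ 2)); last by ring.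
by rewrite !(addr_ge0, mulr_ge0, exprn_ge0).
Qed.

(** Here the vectors a, b, c lie on a line, with coordinates Z1, Z2, Z3 over
    2 r. *)
Lemma unitary_blocks_degenerate : pairE < 0 ->
  delta alpha 0 <= delta alpha 1 + delta alpha 2 + delta alpha 3 ->
  has_unitary_blocks alpha 2.
Proof.
move=> E0 dle.
have h01 := alpha01; have h12 := alpha12; have h23 := alpha23.
have w0 : 0 < alpha 1 + alpha 2 - alpha 0 - alpha 3.
  by rewrite ltNge; apply/negP => h; move: E0; rewrite ltNge pairE_ge0 //; lra.
have [[a0 a1] [a2 a3]] :=
  ((alpha_gt0 0, alpha_gt0 1), (alpha_gt0 2, alpha_gt0 3)).
have W0 : 0 < pairW.
  have : 0 <= (alpha 1 - alpha 0) * (alpha 2 - alpha 0).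
    by rewrite mulr_ge0 // subr_ge0 // (le_trans alpha01).
  have : 0 < alpha 0 * (alpha 1 + alpha 2 - alpha 0 - alpha 3).
    by rewrite mulr_gt0.
  rewrite /pairW; lra.
have VW : 0 <= (alpha 0 + alpha 1) * (alpha 3 - alpha 2).
  by rewrite mulr_ge0 ?subr_ge0 // addr_ge0 ?ltW.
have UV : 0 <= (alpha 0 + alpha 3) * (alpha 2 - alpha 1).
  by rewrite mulr_ge0 ?subr_ge0 // addr_ge0 ?ltW.
have V0 : 0 < pairV by move: W0 VW; rewrite /pairW /pairV; lra.
have U0 : 0 < pairU by move: V0 UV; rewrite /pairU /pairV; lra.
have u0 : 0 < alpha 2 + alpha 3 - alpha 0 - alpha 1 by lra.
have v0 : 0 < alpha 1 + alpha 3 - alpha 0 - alpha 2 by lra.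
have UVW0 : 0 < pairU * pairV * pairW by rewrite !mulr_gt0.
have L : lam = alpha 0 + alpha 1 + alpha 2 + alpha 3.
  by rewrite /lambda sum_ord4.
(* T / (2 r) is the inverse diameter of the circle in which a crossed
   quadrilateral with sides alpha i is inscribed (Brahmagupta) *)
pose M := (alpha 0 + alpha 1 + alpha 2 + alpha 3) *
  (alpha 2 + alpha 3 - alpha 0 - alpha 1) *
  (alpha 1 + alpha 3 - alpha 0 - alpha 2) *
  (alpha 1 + alpha 2 - alpha 0 - alpha 3).
have L0 : 0 < alpha 0 + alpha 1 + alpha 2 + alpha 3 by rewrite !addr_gt0.
have M0 : 0 < M by rewrite /M !mulr_gt0.
pose r := Num.sqrt (pairU * pairV * pairW); pose T := Num.sqrt M.
have r0 : 0 < r by rewrite sqrtr_gt0.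
have T0 : 0 < T by rewrite sqrtr_gt0.
have r2 : r ^+ 2 = pairU * pairV * pairW by rewrite sqr_sqrtr ?ltW.
have T2 : T ^+ 2 = M by rewrite sqr_sqrtr ?ltW.
have rn0 : r != 0 by rewrite gt_eqF.
pose Q := alpha 0 ^+ 2 + alpha 1 ^+ 2 + alpha 2 ^+ 2 + alpha 3 ^+ 2.
(* Zi / (2 r) is the cosine of the inscribed angle over the side alpha i *)
pose Z1 := alpha 1 * (Q - 2 * alpha 1 ^+ 2) - 2 * alpha 0 * alpha 2 * alpha 3.
pose Z2 := alpha 2 * (Q - 2 * alpha 2 ^+ 2) - 2 * alpha 0 * alpha 1 * alpha 3.
pose Z3 := alpha 3 * (Q - 2 * alpha 3 ^+ 2) - 2 * alpha 0 * alpha 1 * alpha 2.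
have norm (Z a : R) : Z ^+ 2 + a ^+ 2 * M = 4 * (pairU * pairV * pairW) ->
    (Z / (2 * r)) ^+ 2 + 0 ^+ 2 + 0 ^+ 2 = 1 - (a * (T / (2 * r))) ^+ 2.
  move=> h; apply/eqP; rewrite -subr_eq0.
  have -> : (Z / (2 * r)) ^+ 2 + 0 ^+ 2 + 0 ^+ 2
       - (1 - (a * (T / (2 * r))) ^+ 2) =
      (Z ^+ 2 + a ^+ 2 * T ^+ 2 - 4 * r ^+ 2) / (4 * r ^+ 2) by field.
  by rewrite T2 r2 h subrr mul0r.
pose S := pairU * pairV + pairU * pairW + pairV * pairW.
have sum_eta : (alpha 2 + alpha 3) * Z1 + (alpha 1 + alpha 3) * Z2 +
    (alpha 1 + alpha 2) * Z3 = 2 * S.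
  by rewrite /Z1 /Z2 /Z3 /Q /S /pairU /pairV /pairW; ring.
have hpos : 0 <= delta alpha 0 ^+ 2 - (S / (2 * r)) ^+ 2.
  (* n1, n2, n3 are the imaginary parts of the other diagonal blocks *)
  pose n1 := (pairU * pairV + pairU * pairW - pairV * pairW) / (2 * r).
  pose n2 := (pairV * pairU + pairV * pairW - pairU * pairW) / (2 * r).
  pose n3 := (pairW * pairU + pairW * pairV - pairU * pairV) / (2 * r).
  have eta_sum : S / (2 * r) = n1 + n2 + n3.
    by rewrite /n1 /n2 /n3 /S; field.
  have sqr_eta (y z w : R) : r ^+ 2 = y * z * w -> y * z + y * w + z * w = S ->
      ((y * z + y * w - z * w) / (2 * r)) ^+ 2 = (S / (2 * r)) ^+ 2 - (z + w).
    move=> h <-; apply/eqP; rewrite -subr_eq0.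
    have -> : ((y * z + y * w - z * w) / (2 * r)) ^+ 2 -
      (((y * z + y * w + z * w) / (2 * r)) ^+ 2 - (z + w)) =
      (z + w) * (r ^+ 2 - y * z * w) / r ^+ 2 by field.
    by rewrite h subrr mulr0 mul0r.
  have s1 : n1 ^+ 2 = (S / (2 * r)) ^+ 2 - (pairV + pairW).
    by apply: sqr_eta.
  have s2 : n2 ^+ 2 = (S / (2 * r)) ^+ 2 - (pairU + pairW).
    by apply: sqr_eta; rewrite ?r2 /S; ring.
  have s3 : n3 ^+ 2 = (S / (2 * r)) ^+ 2 - (pairU + pairV).
    by apply: sqr_eta; rewrite ?r2 /S; ring.
  have r20 : 0 < 2 * r by rewrite mulr_gt0.
  have UVge : 0 <= pairU - pairV.
    by rewrite (_ : _ - _ = (alpha 0 + alpha 3) * (alpha 2 - alpha 1)) //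
       /pairU /pairV; ring.
  have VWge : 0 <= pairV - pairW.
    by rewrite (_ : _ - _ = (alpha 0 + alpha 1) * (alpha 3 - alpha 2)) //
       /pairV /pairW; ring.
  have p1 : 0 <= n1.
    apply: divr_ge0; last exact: ltW.
    have := mulr_ge0 (ltW W0) UVge; have := mulr_ge0 (ltW U0) (ltW V0); lra.
  have p2 : 0 <= n2.
    apply: divr_ge0; last exact: ltW.
    have := mulr_ge0 (ltW U0) VWge; have := mulr_ge0 (ltW V0) (ltW W0); lra.
  have p3 : 0 <= n3.
    apply: divr_ge0; last exact: ltW.
    by move: (ltW E0); rewrite /pairE; lra.
  have := (sqr_delta delta_gt0 0, sqr_delta delta_gt0 1, sqr_delta delta_gt0 2,
    sqr_delta delta_gt0 3); rewrite L => -[[[e0 e1] e2] e3].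
  apply: (@momentum_defect _ (delta alpha 0) (delta alpha 1)
    (delta alpha 2) (delta alpha 3) (S / (2 * r)) n1 n2 n3) => //.
  - by rewrite s1 e0 e1 /pairV /pairW; ring.
  - by rewrite s2 e0 e2 /pairU /pairW; ring.
  - by rewrite s3 e0 e3 /pairU /pairV; ring.
apply: (@quaternion_construction _ _ alpha_gt0 delta_gt0 (T / (2 * r))
  (Num.sqrt (delta alpha 0 ^+ 2 - (S / (2 * r)) ^+ 2))
  (Z1 / (2 * r)) 0 0 (Z2 / (2 * r)) 0 0 (Z3 / (2 * r)) 0 0 (S / (2 * r)) 0 0).
- by rewrite mulf_neq0 ?invr_neq0 ?mulf_neq0 // ?gt_eqF ?ltr0n.
- by apply: norm; rewrite /Z1 /Q /M /pairU /pairV /pairW; ring.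
- by apply: norm; rewrite /Z2 /Q /M /pairU /pairV /pairW; ring.
- by apply: norm; rewrite /Z3 /Q /M /pairU /pairV /pairW; ring.
- transitivity (T / (8 * r ^+ 3) * (alpha 1 * (Z2 * Z3) + alpha 2 * (Z1 * Z3)
      + alpha 3 * (Z1 * Z2) + 4 * alpha 0 * r ^+ 2
      - alpha 1 * alpha 2 * alpha 3 * T ^+ 2)); first by field.
  rewrite T2 r2 [X in _ * X](_ : _ = 0) ?mulr0 //.
  by rewrite /Z1 /Z2 /Z3 /Q /M /pairU /pairV /pairW; ring.
- transitivity (T / (4 * r ^+ 2) * (2 * S)); first by field.
  by rewrite -sum_eta; field.
- by ring.
- by ring.
- by rewrite sqr_sqrtr //; ring.
Qed.
End DegenerateQuadrilateral.

(** * A quadrilateral with a real first diagonal block *)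

(** Two plane vectors with prescribed inner products and oriented area. *)
Lemma planar_gram (R : rcfType) (P S Z T : R) :
  0 <= P -> 0 <= S -> P * S = Z ^+ 2 + T ^+ 2 ->
  exists a1 a2 b1 b2, [/\ a1 ^+ 2 + a2 ^+ 2 = P, b1 ^+ 2 + b2 ^+ 2 = S,
    a1 * b1 + a2 * b2 = Z & a1 * b2 - a2 * b1 = T].
Proof.
move=> P0 S0 PS; have [Pz|Pn0] := eqVneq P 0.
  have /eqP : Z ^+ 2 + T ^+ 2 = 0 by rewrite -PS Pz mul0r.
  rewrite paddr_eq0 ?sqr_ge0 // !sqrf_eq0 => /andP[/eqP Z0 /eqP T0].
  by exists 0, 0, (Num.sqrt S), 0; rewrite sqr_sqrtr // Z0 T0 Pz; split; ring.
have P2 : Num.sqrt P ^+ 2 = P by rewrite sqr_sqrtr.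
have r0 : Num.sqrt P != 0 by rewrite gt_eqF // sqrtr_gt0 lt_def Pn0.
exists (Num.sqrt P), 0, (Z / Num.sqrt P), (T / Num.sqrt P); split.
- by rewrite P2; ring.
- by rewrite !exprMn -mulrDl -PS exprVn P2 mulrAC mulfV // mul1r.
- by field.
- by field.
Qed.

Section BalancedQuadrilateral.
Variables (R : realType) (alpha : 'I_4 -> R).
Hypothesis alpha_gt0 : forall i, 0 < alpha i.
Hypothesis delta_gt0 : forall i, 0 < delta alpha i.
Notation d := (alpha 0).
Notation p := (alpha 1).
Notation q := (alpha 2).
Notation r := (alpha 3).

(** The index 0 now carries the largest alpha.  The equation xi = 0 says that
    (q + r) a + (p + r) b + (p + q) c is a multiple of a x b + b x c + c x a;
    so a, b, c have the same component z along that direction, and their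
    projections to the orthogonal plane have the origin as barycentre with
    weights q + r, p + r, p + q.  The last hypothesis is the condition that z be
    real. *)
Lemma unitary_blocks_balanced :
  p <= d -> q <= d -> r <= d -> d < p + q + r ->
  0 <= p * q * r * (p + q + r + 3 * d)
       - (p + q + r - d) * d * (p * q + p * r + q * r) ->
  has_unitary_blocks alpha 2.
Proof.
move=> pd qd rd gd; set E := _ - _ => E0.
have [[d0 p0] [q0 r0]] :=
  ((alpha_gt0 0, alpha_gt0 1), (alpha_gt0 2, alpha_gt0 3)).
pose g := p + q + r - d.
have g0 : 0 < g by rewrite subr_gt0.
pose M := 4 * (p * q * r * d).
have M0 : 0 < M by rewrite /M !mulr_gt0.
have Mn0 : M != 0 by rewrite gt_eqF.
pose m := Num.sqrt M.
have m0 : 0 < m by rewrite sqrtr_gt0.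
have mn0 : m != 0 by rewrite gt_eqF.
have m2 : m ^+ 2 = M by rewrite sqr_sqrtr // ltW.
pose e := Num.sqrt E.
have e2 : e ^+ 2 = E by rewrite sqr_sqrtr.
(* Gm p, Gm q, Z and T are the inner products and the area of the projections
   of a and b *)
pose Gm x := g * (d * (p * q + p * r + q * r) - p * q * r - g * x ^+ 2) / M.
pose Z := (M - 2 * g * r * d * (p + q) + g ^+ 2 * p * q - E) / M.
pose T := g * e * (p + q) / M.
have Gm_ge0 x y z : 0 < x -> 0 < y -> 0 < z -> x <= d -> y <= d -> z <= d ->
    x + y + z = p + q + r ->
    x * y + x * z + y * z = p * q + p * r + q * r ->
    x * y * z = p * q * r -> 0 <= Gm x.
  move=> x0 y0 z0 xd yd zd s1 s2 s3.
  rewrite /Gm /g -s1 -s2 -s3; apply: divr_ge0; last exact: ltW.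
  apply: mulr_ge0; first by rewrite s1 ltW.
  rewrite (_ : _ - _ = (d - x) * (x * y + x * z + y * z) + (d - x) * x ^+ 2);
    last by ring.
  by rewrite addr_ge0 ?mulr_ge0 ?subr_ge0 ?addr_ge0 ?mulr_ge0 ?sqr_ge0 // ltW.
have [a1 [a2 [b1 [b2 [aa bb ab axb]]]]] : exists a1 a2 b1 b2,
   [/\ a1 ^+ 2 + a2 ^+ 2 = Gm p, b1 ^+ 2 + b2 ^+ 2 = Gm q,
    a1 * b1 + a2 * b2 = Z & a1 * b2 - a2 * b1 = T].
  apply: planar_gram.
  - by apply: (@Gm_ge0 p q r).
  - by apply: (@Gm_ge0 q p r) => //; ring.
  - have -> : T ^+ 2 = g ^+ 2 * E * (p + q) ^+ 2 / M ^+ 2.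
      by rewrite -e2 /T; field.
    rewrite /Gm /Z -[M]/(4 * (p * q * r * d)) /E /g; field.
    by rewrite !gt_eqF.
have pq0 : p + q != 0 by rewrite gt_eqF // addr_gt0.
(* the projection of c is determined by the barycentre condition *)
pose c1 := - ((q + r) * a1 + (p + r) * b1) / (p + q).
pose c2 := - ((q + r) * a2 + (p + r) * b2) / (p + q).
pose z := - e / m.
pose k := g / m.
have k2 : k ^+ 2 = g ^+ 2 / M by rewrite expr_div_n m2.
have z2 : z ^+ 2 = E / M by rewrite expr_div_n m2 sqrrN e2.
have kz : T = - (k * z) * (p + q) by rewrite /T -m2 /k /z; field.
have bc : b1 * c1 + b2 * c2 = - ((q + r) * Z + (p + r) * Gm q) / (p + q).
  by rewrite -bb -ab /c1 /c2; field.
have ac : a1 * c1 + a2 * c2 = - ((q + r) * Gm p + (p + r) * Z) / (p + q).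
  by rewrite -aa -ab /c1 /c2; field.
have cc : c1 ^+ 2 + c2 ^+ 2 = ((q + r) ^+ 2 * Gm p + (p + r) ^+ 2 * Gm q
    + 2 * (q + r) * (p + r) * Z) / (p + q) ^+ 2.
  by rewrite -aa -bb -ab /c1 /c2; field.
have area : (a1 * b2 - a2 * b1) + (b1 * c2 - b2 * c1) + (c1 * a2 - c2 * a1) =
    - 2 * (k * z) * (p + q + r).
  transitivity (2 * (p + q + r) / (p + q) * (a1 * b2 - a2 * b1)).
    by rewrite /c1 /c2; field.
  by rewrite axb kz; field.
apply: (@quaternion_construction _ _ alpha_gt0 delta_gt0 k (delta alpha 0)
  a1 a2 z b1 b2 z c1 c2 z 0 0 0).
- by rewrite mulf_neq0 ?invr_neq0 // gt_eqF.
- rewrite aa (exprMn _ p k) k2 z2 /Gm -[M]/(4 * (p * q * r * d)) /E /g; field.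
  by rewrite !gt_eqF.
- rewrite bb (exprMn _ q k) k2 z2 /Gm -[M]/(4 * (p * q * r * d)) /E /g; field.
  by rewrite !gt_eqF.
- rewrite cc (exprMn _ r k) k2 z2 /Gm /Z -[M]/(4 * (p * q * r * d)) /E /g.
  by field; rewrite pq0 !gt_eqF.
- rewrite bc ac ab.
  transitivity (k * (p * (- ((q + r) * Z + (p + r) * Gm q) / (p + q) + z ^+ 2)
    + q * (- ((q + r) * Gm p + (p + r) * Z) / (p + q) + z ^+ 2)
    + r * (Z + z ^+ 2) + d - p * q * r * k ^+ 2)
    + z * ((a1 * b2 - a2 * b1) + (b1 * c2 - b2 * c1) + (c1 * a2 - c2 * a1))).
    by ring.
  rewrite area.
  transitivity (k * (p * (- ((q + r) * Z + (p + r) * Gm q) / (p + q) + z ^+ 2)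
    + q * (- ((q + r) * Gm p + (p + r) * Z) / (p + q) + z ^+ 2)
    + r * (Z + z ^+ 2) + d - p * q * r * k ^+ 2 - 2 * (p + q + r) * z ^+ 2)).
    by ring.
  rewrite z2 k2 [X in _ * X](_ : _ = 0) ?mulr0 //.
  rewrite /Gm /Z -[M]/(4 * (p * q * r * d)) /E /g.
  by field; rewrite pq0 !gt_eqF.
- by rewrite /c1 /c2; field.
- by rewrite /c1 /c2; field.
- by rewrite area; ring.
- by ring.
Qed.
End BalancedQuadrilateral.

(** * Relabelling and conclusion *)

Section Relabel.
Variables (R : realType) (alpha : 'I_4 -> R) (s s' : 'I_4 -> 'I_4).
Hypotheses (sK : cancel s s') (s'K : cancel s' s).

Lemma lambda_relabel : lambda (alpha \o s) = lambda alpha.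
Proof.
by rewrite /lambda [RHS](reindex s) //; exists s' => i _.
Qed.

Lemma delta_relabel i : delta (alpha \o s) i = delta alpha (s i).
Proof. by rewrite /delta lambda_relabel. Qed.

Lemma Dmx_relabel i j : Dmx (alpha \o s) i j = Dmx alpha (s i) (s j).
Proof. by rewrite !mxE (inj_eq (can_inj sK)) delta_relabel. Qed.

Lemma unitary_blocks_relabel n :
  has_unitary_blocks (alpha \o s) n -> has_unitary_blocks alpha n.
Proof.
move=> [v [vU BU]]; exists (fun i j => v (s' i) (s' j)); split=> [i j //|].
pose B i j := (Dmx (alpha \o s) i j)%:C%C *: v i j.
pose B' i j := (Dmx alpha i j)%:C%C *: v (s' i) (s' j).
have rows := (mxblock_unitaryP B).1 BU.
apply/(mxblock_unitaryP B') => i j.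
rewrite -(inj_eq (can_inj s'K)) -rows [RHS](reindex s').
  2: by exists s => k _.
rewrite /B /B'.
by apply: eq_bigr => k _; rewrite !Dmx_relabel !s'K.
Qed.
End Relabel.

(** The values of x^2 - lambda x at two points of sum less than lambda are in
    the order opposite to that of the points. *)
Lemma alpha_le_delta (R : realType) (alpha : 'I_4 -> R) (i j : 'I_4) :
  (forall k, 0 < delta alpha k) -> alpha i + alpha j < lambda alpha ->
  delta alpha j <= delta alpha i -> alpha i <= alpha j.
Proof.
move=> d0 lt le; rewrite leNgt; apply/negP => ji.
have : delta alpha j ^+ 2 <= delta alpha i ^+ 2.
  by rewrite ler_sqr ?nnegrE ?(ltW (d0 _)).
rewrite !sqr_delta // -subr_ge0.
rewrite (_ : _ - _ = - ((alpha i - alpha j) *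
  (lambda alpha - (alpha i + alpha j)))); last by ring.
by rewrite oppr_ge0 leNgt mulr_gt0 // subr_gt0.
Qed.

Theorem theorem4p14 (R : realType) (alpha : 'I_4 -> R)
    (alpha_gt0 : forall i, 0 < alpha i)
    (lambda_gt2 : 2 < lambda alpha)
    (alpha_le : forall i,
       alpha i <= (lambda alpha - Num.sqrt (lambda alpha ^+ 2 - 4)) / 2)
    (delta01 : delta alpha 1 <= delta alpha 0)
    (delta12 : delta alpha 2 <= delta alpha 1)
    (delta23 : delta alpha 3 <= delta alpha 2)
    (delta3_gt0 : 0 < delta alpha 3) :
  ((exists n : nat, (0 < n)%N /\ has_unitary_blocks alpha n) <->
     has_unitary_blocks alpha 2) /\
  (has_unitary_blocks alpha 2 <->
     delta alpha 0 - delta alpha 1 - delta alpha 2 - delta alpha 3 <= 0).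
Proof.
have delta_gt0 i : 0 < delta alpha i.
  have d2 := lt_le_trans delta3_gt0 delta23.
  have d1 := lt_le_trans d2 delta12.
  by case: (ord4P i) => -> //; exact: lt_le_trans d1 delta01.
have [[a0 a1] [a2 a3]] :=
  ((alpha_gt0 0, alpha_gt0 1), (alpha_gt0 2, alpha_gt0 3)).
have L : lambda alpha = alpha 0 + alpha 1 + alpha 2 + alpha 3.
  by rewrite /lambda sum_ord4.
have alpha01 : alpha 0 <= alpha 1 by apply: alpha_le_delta => //; lra.
have alpha12 : alpha 1 <= alpha 2 by apply: alpha_le_delta => //; lra.
have alpha23 : alpha 2 <= alpha 3 by apply: alpha_le_delta => //; lra.
have nec n : (0 < n)%N -> has_unitary_blocks alpha n ->
    delta alpha 0 - delta alpha 1 - delta alpha 2 - delta alpha 3 <= 0.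
  move=> n0 /(unitary_blocks_delta_le alpha_gt0 delta_gt0 n0); lra.
have suf : delta alpha 0 - delta alpha 1 - delta alpha 2 - delta alpha 3 <= 0 ->
    has_unitary_blocks alpha 2.
  move=> dle; have [E0|E0] := ltP (pairE alpha) 0.
    by apply: unitary_blocks_degenerate => //; lra.
  (* move the largest alpha to the index 0 *)
  apply: (unitary_blocks_relabel (subrK 1) (addrK 1)).
  set beta := alpha \o _.
  have b0 : beta 0 = alpha 3 by congr alpha; apply: val_inj.
  have b1 : beta 1 = alpha 0 by congr alpha; apply: val_inj.
  have b2 : beta 2 = alpha 1 by congr alpha; apply: val_inj.
  have b3 : beta 3 = alpha 2 by congr alpha; apply: val_inj.
  have sq0 : 0 < Num.sqrt (lambda alpha ^+ 2 - 4).
    by rewrite sqrtr_gt0; nra.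
  have a3le := alpha_le 3.
  apply: unitary_blocks_balanced; rewrite ?b0 ?b1 ?b2 ?b3 //; try lra.
  - by move=> i; exact: alpha_gt0.
  - by move=> i; rewrite (delta_relabel _ (subrK 1) (addrK 1)).
  - move: E0; rewrite /pairE /pairU /pairV /pairW; lra.
split; last by split; [exact: nec | exact: suf].
split=> [[n [n0 h]]|h]; last by exists 2.
exact: suf (nec n n0 h).
Qed.
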